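(* Let $K\subset L$ be simplicial complexes on a common vertex set and let $r$ be a prime. Assume that there exists a $\mathbb{Z}/r$-equivariant map $f\colon K^{*r}_\Delta\to S^N$, where the $N$-sphere $S^N$ carries a free linear $\mathbb{Z}/r$-action. If $\chi(\mathrm{KG}^r(K,L))\le c$, then there exists a $\mathbb{Z}/r$-equivariant map $F\colon L^{*r}_\Delta\to S^{N+(r-1)c}$, where the $\mathbb{Z}/r$-action on $S^{N+(r-1)c}$ is free.
   Context: A missing face of a simplicial complex $K$ on vertex set $V$ is a set $\sigma\subset V$ with $\sigma\notin K$ but every proper subset of $\sigma$ in $K$. $\mathrm{KG}^r(K,L)$ is the hypergraph whose vertices are the missing faces of $K$ that are faces of $L$, with a hyperedge for every $r$ pairwise disjoint such missing faces; $\chi$ denotes the chromatic number (least number of colors so that no hyperedge is monochromatic). For a simplicial complex $M$, the ($2$-wise) deleted $r$-fold join $M^{*r}_\Delta$ is the simplicial complex whose faces are the joins $\sigma_1*\dots*\sigma_r$ (i.e. $\bigsqcup_i\sigma_i\times\{i\}$) of pairwise disjoint faces $\sigma_1,\dots,\sigma_r$ of $M$; $\mathbb{Z}/r$ acts on it by cyclically permuting the $r$ join factors. *)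

(* Defs.v *)
From HB Require Import structures.
From mathcomp Require Import all_boot all_order all_algebra.

Set Implicit Arguments.
Unset Strict Implicit.
Unset Printing Implicit Defensive.

Import Order.TTheory GRing.Theory Num.Theory.

Section Complexes.
Variable V : finType.
Implicit Types K L M : {set {set V}}.

(* The empty face belongs to every complex; a point of V need not be a face,
   in which case its singleton is a missing face. *)
Definition simplicial_complex K : Prop :=
  set0 \in K /\ (forall s t : {set V}, s \in K -> t \subset s -> t \in K).

Definition missing_face K (s : {set V}) : bool :=
  (s \notin K) && [forall t : {set V}, (t \proper s) ==> (t \in K)].

Definition missing_face_in K L : finType :=
  {s : {set V} | missing_face K s && (s \in L)}.

(* The hyperedges of KG^r(K,L), a hypergraph with vertex type
   [missing_face_in K L]. *)
Definition KG (r : nat) K L : {set {set missing_face_in K L}} :=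
  [set e : {set missing_face_in K L} | (#|e| == r) &&
    [forall s in e, forall t in e,
       (s != t) ==> [disjoint val s & val t]]].

(* The join factors are indexed by Z/r.  Beware that 'Z_r is Z/r only for
   r > 1. *)
Definition join_face (r : nat) (sigma : {ffun 'Z_r -> {set V}}) :
    {set V * 'Z_r} :=
  \bigcup_(i : 'Z_r) setX (sigma i) [set i].

Definition deleted_join (r : nat) M : {set {set V * 'Z_r}} :=
  [set join_face sigma | sigma : {ffun 'Z_r -> {set V}} &
     [forall i, sigma i \in M] &&
     [forall i, forall j, (i != j) ==> [disjoint sigma i & sigma j]]].

End Complexes.

Section Chromatic.
Variables (T : finType) (E : {set {set T}}).

Definition colorable (k : nat) : bool :=
  [exists f : {ffun T -> 'I_k},
    [forall e in E, ~~ [forall x in e, forall y in e, f x == f y]]].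

(* The default value #|T| of the minimum is itself a number of colors that
   suffices as soon as every hyperedge has at least two vertices, see
   [chromatic_numberP]. *)
Definition chromatic_number : nat :=
  [arg min_(k < (ord_max : 'I_#|T|.+1) | colorable k) (k : nat)].

Lemma colorable_card :
  (forall e, e \in E -> 1 < #|e|) -> colorable #|T|.
Proof.
move=> E2; apply/existsP; exists [ffun x => enum_rank x].
apply/forall_inP => e /E2 /card_gt1P [x [y [xe ye xy]]].
apply: contra xy => /forall_inP /(_ x xe) /forall_inP /(_ y ye).
by rewrite !ffunE => /eqP /enum_rank_inj ->.
Qed.

Lemma chromatic_numberP :
  (forall e, e \in E -> 1 < #|e|) ->
  colorable chromatic_number /\
  (forall k, colorable k -> chromatic_number <= k).
Proof.
move=> E2; rewrite /chromatic_number; case: arg_minnP => [|i ci mi].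
  exact: colorable_card.
split=> // k ck; case: (leqP k #|T|) => [|lt_k].
  by rewrite -ltnS => lek; exact: (mi (Ordinal lek) ck).
by rewrite (leq_trans _ (ltnW lt_k)) // -ltnS.
Qed.

End Chromatic.

From mathcomp Require Import all_classical all_reals all_analysis.
Import numFieldNormedType.Exports.

Local Open Scope classical_set_scope.
Local Open Scope ring_scope.

(* Points in barycentric coordinates.  As W is finite, the topology of
   pointwise convergence is the Euclidean one. *)
Definition realization (R : realType) (W : finType) (M : {set {set W}}) :
    set {ptws W -> R} :=
  [set x | [/\ forall w, 0 <= x w,
               \sum_(w : W) x w = 1 &
               finset (fun w => x w != 0) \in M]].

Definition sphere (R : realType) (n : nat) : set 'rV[R]_n.+1 :=
  [set x | \sum_(i < n.+1) x 0 i ^+ 2 = 1].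

(* Spaces are subsets X of an ambient space, with the subspace topology;
   maps and actions are total functions of which only the values on X
   matter. *)
Section Actions.
Variable r : nat.

Record Zr_action (T : topologicalType) (X : set T)
    (a : 'Z_r -> T -> T) : Prop := {
  act_stable : forall g x, X x -> X (a g x);
  act_continuous : forall g, {within X, continuous (a g)};
  act0 : forall x, X x -> a 0 x = x;
  actD : forall g h x, X x -> a (g + h) x = a g (a h x) }.

Definition free_action (T : Type) (X : set T) (a : 'Z_r -> T -> T) : Prop :=
  forall g x, X x -> a g x = x -> g = 0.

Record equivariant_map (T U : topologicalType) (X : set T) (Y : set U)
    (a : 'Z_r -> T -> T) (b : 'Z_r -> U -> U) (f : T -> U) : Prop := {
  eqv_maps : forall x, X x -> Y (f x);
  eqv_continuous : {within X, continuous f};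
  eqv_commutes : forall g x, X x -> f (a g x) = b g (f x) }.

(* g moves the i-th join factor to the (i + g)-th. *)
Definition cyclic_shift (R : realType) (V : finType) (g : 'Z_r)
    (x : {ptws V * 'Z_r -> R}) : {ptws V * 'Z_r -> R} :=
  fun w => x (w.1, w.2 - g).

End Actions.

(* Main.v *)
(* Fix a proper colouring of KG^r(K,L).  To a point x of |L^{*r}_Delta| attach,
   for each join factor j and each colour k, the weight
   sum_tau prod_{v in tau} x(v,j), over the missing faces tau of colour k.  It
   is positive exactly when the j-th factor of the support contains such a tau,
   so for fixed k it vanishes for some j: otherwise r pairwise disjoint missing
   faces would share the colour k.  Hence if, for every k, the weights do not
   depend on j, then they all vanish and x lies in |K^{*r}_Delta|.  The class u
   of the weights modulo vectors constant in j lives in a representation of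
   dimension (r-1)c without nonzero fixed vectors of any nontrivial element, r
   being prime.  Extending f to an equivariant map h into R^{N+1} (Tietze, then
   averaging over Z/r), the map (h, u) is equivariant without zeros, and its
   radial projection to the sphere is F. *)
Require Import Defs.
From HB Require Import structures.
From mathcomp Require Import all_boot all_order all_algebra.
From mathcomp Require Import all_classical all_reals all_analysis.
From mathcomp Require Import ring.
Import Order.TTheory GRing.Theory Num.Theory.
Import numFieldNormedType.Exports.

Local Open Scope ring_scope.

Set Implicit Arguments.
Unset Strict Implicit.
Unset Printing Implicit Defensive.

(** * Continuity in coordinates, normality and Tietze extension *)

Lemma continuous_rV (R : realType) (T : topologicalType) n (F : T -> 'rV[R]_n) :
  (forall i, continuous (fun x => F x 0 i)) -> continuous F.
Proof.
move=> cF x A [P nP sPA];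
apply: (@filterS _ _ _ [set y | forall i, P 0 i (F y 0 i)]).
  by move=> y Py; apply: sPA => i j; rewrite ord1; exact: Py.
by apply: filter_forall => i; apply: cF; exact: nP.
Qed.

Lemma continuous_ptws (T U : topologicalType) (W : finType)
    (F : T -> {ptws W -> U}) :
  (forall w, continuous (fun x => F x w)) -> continuous F.
Proof.
move=> cF x; apply/cvg_sup => w A [B [[C oC <-] /= CFx] sBA].
by apply: (filterS sBA); apply: (cF w x); apply: open_nbhs_nbhs.
Qed.

Lemma continuous_sum (R : realType) (T : topologicalType) (I : finType)
    (P : pred I) (F : I -> T -> R) :
  (forall i, P i -> continuous (F i)) ->
  continuous (fun x => \sum_(i | P i) F i x).
Proof. by apply: continuous_big; exact: (@add_continuous R). Qed.

Lemma continuous_prod (R : realType) (T : topologicalType) (I : finType)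
    (P : pred I) (F : I -> T -> R) :
  (forall i, P i -> continuous (F i)) ->
  continuous (fun x => \prod_(i | P i) F i x).
Proof. by apply: continuous_big; exact: mul_continuous. Qed.

Lemma continuous_ptws_eval (R : realType) (W : finType) (w : W) :
  continuous (fun x : {ptws W -> R} => x w).
Proof. exact: (@proj_continuous W (fun _ => R) w). Qed.

(** Enumerating [W] gives a homeomorphism with ['rV[R]_#|W|], which is normal because it is
    pseudometric; separating open sets are pulled back along it. *)
Lemma ptws_normal (R : realType) (W : finType) : normal_space {ptws W -> R}.
Proof.
pose toM (x : {ptws W -> R}) : 'rV[R]_#|W| := \row_i x (enum_val i).
pose ofM (y : 'rV[R]_#|W|) : {ptws W -> R} := fun w => y 0 (enum_rank w).
have toMK x : ofM (toM x) = x.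
  by apply: funext => w; rewrite /ofM mxE enum_rankK.
have ctoM : continuous toM.
  apply: continuous_rV => i;
  rewrite (_ : (fun _ => _) =
    (fun x : {ptws W -> R} => x (enum_val i))).
    exact: continuous_ptws_eval.
  by apply: funext => x; rewrite mxE.
have cofM : continuous ofM by apply: continuous_ptws => w;
  exact: coord_continuous.
apply/(@normal_openP R) => A B cA cB AB0.
have [] := (@normal_openP R _).1 (@pseudometric_normal R 'rV[R]_#|W|)
  (ofM @^-1` A)%classic (ofM @^-1` B)%classic.
- by apply: preimage_closed => // y _; exact: cofM.
- by apply: preimage_closed => // y _; exact: cofM.
- by rewrite -preimage_setI AB0 preimage_set0.
move=> U [U' [oU oU' AU BU' UU']].
exists (toM @^-1` U)%classic, (toM @^-1` U')%classic; split.
- by apply: open_comp => // x _; exact: ctoM.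
- by apply: open_comp => // x _; exact: ctoM.
- by move=> x Ax; apply: AU; rewrite /= toMK.
- by move=> x Bx; apply: BU'; rewrite /= toMK.
- by rewrite -preimage_setI UU' preimage_set0.
Qed.

(** Each coordinate is extended separately by the bounded, real-valued Tietze theorem, which is
    where [M] enters. *)
Lemma tietze_rV (R : realType) (T : topologicalType) n (A : set T)
    (f : T -> 'rV[R]_n) (M : R) :
  normal_space T -> closed A -> {within A, continuous f}%classic -> 0 < M ->
  (forall x i, A x -> `|f x 0 i| <= M) ->
  exists2 g : T -> 'rV[R]_n, continuous g & {in A, f =1 g}.
Proof.
move=> nT cA cf M0 fM.
have /choice[g gP] i : exists g : T -> R,
    continuous g /\ {in A, (fun x => f x 0 i) =1 g}.
  have [||g [fg cg _]] := @continuous_bounded_extension T R nT A cA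
    (fun x => f x 0 i) M M0.
  - move=> x;
    exact: (continuous_comp (cf x) (@coord_continuous _ _ _ 0 i (f x))).
  - by move=> x Ax; exact: fM.
  - by exists g.
exists (fun x => \row_i g i x).
  apply: continuous_rV => i; rewrite (_ : (fun _ => _) = g i);
    first by case: (gP i).
  by apply: funext => x; rewrite mxE.
by move=> x Ax; apply/rowP => i; rewrite mxE; case: (gP i) => _ /(_ x Ax).
Qed.

(** * Radial projection onto the Euclidean sphere *)

Section RadialProjection.
Variable R : realType.

(** The norm that ['rV[R]_n] carries by default is the maximum norm, whose unit sphere is not
    [sphere]. *)
Definition euclidean_norm n (y : 'rV[R]_n) : R := Num.sqrt (\sum_i y 0 i ^+ 2).

Definition radial n (y : 'rV[R]_n) : 'rV[R]_n := (euclidean_norm y)^-1 *: y.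

Lemma euclidean_norm_gt0 n (y : 'rV[R]_n) : y != 0 -> 0 < euclidean_norm y.
Proof.
move=> y0; rewrite sqrtr_gt0 lt_neqAle sumr_ge0 ?andbT; last first.
  by move=> i _; exact: sqr_ge0.
apply: contra y0 => /eqP/esym s0; apply/eqP/rowP => i; rewrite mxE.
have /(_ i isT)/eqP := psumr_eq0P (fun i _ => sqr_ge0 (y 0 i)) s0.
by rewrite sqrf_eq0 => /eqP.
Qed.

Lemma euclidean_normZ n (k : R) (y : 'rV[R]_n) :
  0 <= k -> euclidean_norm (k *: y) = k * euclidean_norm y.
Proof.
move=> k0; rewrite /euclidean_norm.
under eq_bigr do rewrite mxE exprMn.
by rewrite -mulr_sumr sqrtrM ?sqr_ge0// sqrtr_sqr ger0_norm.
Qed.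

Lemma euclidean_norm_sphere n (y : 'rV[R]_n.+1) :
  @sphere R n y <-> euclidean_norm y = 1.
Proof.
rewrite /sphere /euclidean_norm /=; split=> [->|]; first by rewrite sqrtr1.
move=> /(congr1 (fun z => z ^+ 2)); rewrite sqr_sqrtr ?expr1n//.
by apply: sumr_ge0 => i _; exact: sqr_ge0.
Qed.

Lemma sphere_neq0 n (y : 'rV[R]_n.+1) : @sphere R n y -> y != 0.
Proof.
apply: contraPneq => ->; rewrite /sphere /=.
under eq_bigr do rewrite mxE expr0n.
by rewrite big1// => /esym/eqP; rewrite oner_eq0.
Qed.

Lemma sphere_radial n (y : 'rV[R]_n.+1) : y != 0 -> @sphere R n (radial y).
Proof.
move=> /euclidean_norm_gt0 y0; apply/euclidean_norm_sphere.
by rewrite euclidean_normZ ?invr_ge0 ?(ltW y0)// mulVf// gt_eqF.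
Qed.

Lemma radialZ n (k : R) (y : 'rV[R]_n) : 0 < k -> radial (k *: y) = radial y.
Proof.
move=> k0; rewrite /radial euclidean_normZ ?(ltW k0)// scalerA invfM mulrAC.
by rewrite mulVf ?mul1r// gt_eqF.
Qed.

Lemma radial_sphere n (y : 'rV[R]_n.+1) : @sphere R n y -> radial y = y.
Proof.
by move=> /euclidean_norm_sphere y1; rewrite /radial y1 invr1 scale1r.
Qed.

Lemma continuous_radial n (y : 'rV[R]_n) :
  y != 0 -> {for y, continuous (@radial n)}.
Proof.
move=> y0; have cnorm : continuous (@euclidean_norm n).
  move=> z; apply: (@continuous_comp _ _ _
    (fun z : 'rV[R]_n => \sum_i z 0 i ^+ 2)).
    apply: continuous_sum => i _ {}z.
    by apply: continuousM; exact: coord_continuous.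
  exact: sqrt_continuous.
apply: continuousZ; last exact: cvg_id.
by apply: continuousV; [rewrite gt_eqF ?euclidean_norm_gt0 | exact: cnorm].
Qed.

Lemma linear_rV_continuous m n (f : 'rV[R]_m -> 'rV[R]_n) :
  linear f -> continuous f.
Proof.
move=> lf; pose F : {linear _ -> _} :=
  HB.pack f (GRing.isLinear.Build _ _ _ _ f lf).
have fE y : f y = y *m lin1_mx F by rewrite mul_rV_lin1.
apply: continuous_rV => i.
rewrite (_ : (fun _ => _) = fun y : 'rV[R]_m => \sum_j y 0 j * lin1_mx F j i).
  apply: continuous_sum => j _ y.
  by apply: continuousM; [exact: coord_continuous | exact: cst_continuous].
by apply: funext => y; rewrite fE mxE.
Qed.

End RadialProjection.

(** * Linear actions of [Z/r] and equivariant maps *)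

Lemma Zp_mulrn_order (p : nat) (g : 'Z_p.+2) : g *+ p.+2 = 0.
Proof. by apply/val_inj; rewrite Zp_mulrn /= modnMl. Qed.

(* The action [rho] need not be orthogonal: conjugating it with the radial
   projection still gives a free action on the sphere, since an eigenvector of
   [rho g] with a positive eigenvalue is fixed, [rho g] having finite order. *)
Lemma radial_equivariant_map (R : realType) (p n : nat)
    (rho : 'Z_p.+2 -> 'rV[R]_n.+1 -> 'rV[R]_n.+1)
    (T : topologicalType) (X : set T) (s : 'Z_p.+2 -> T -> T)
    (phi : T -> 'rV[R]_n.+1) :
  (forall g, linear (rho g)) -> (forall y, rho 0 y = y) ->
  (forall g h y, rho (g + h) y = rho g (rho h y)) ->
  (forall g y, y != 0 -> rho g y = y -> g = 0) ->
  continuous phi -> (forall x, X x -> phi x != 0) ->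
  (forall g x, X x -> phi (s g x) = rho g (phi x)) ->
  exists b : 'Z_p.+2 -> 'rV[R]_n.+1 -> 'rV[R]_n.+1,
    [/\ Zr_action (@sphere R n) b, free_action (@sphere R n) b &
        exists F, equivariant_map X (@sphere R n) s b F].
Proof.
move=> rho_lin rho0 rhoD rho_free cphi phi0 phiE.
have rhoZ g k y : rho g (k *: y) = k *: rho g y
  by exact: (scalable_linear (rho_lin g)).
(* [rho (- g)] inverts [rho g], and it sends 0 to 0 by homogeneity. *)
have rho_neq0 g y : y != 0 -> rho g y != 0.
  apply: contra_neq => gy0; rewrite -(rho0 y) -(addNr g) rhoD gy0.
  by rewrite -(scale0r 0) rhoZ !scale0r.
have rho_radial g y : y != 0 -> radial (rho g (radial y)) = radial (rho g y).
  by move=> y0; rewrite rhoZ radialZ// invr_gt0 euclidean_norm_gt0.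
exists (fun g y => radial (rho g y)); split.
- split.
  + by move=> g y /sphere_neq0 y0; exact/sphere_radial/rho_neq0.
  + move=> g; apply: continuous_in_subspaceT => y;
      rewrite inE => /sphere_neq0 y0.
    apply: (@continuous_comp _ _ _ (rho g)); first exact: linear_rV_continuous.
    exact/continuous_radial/rho_neq0.
  + by move=> y Sy; rewrite rho0 radial_sphere.
  + by move=> g h y /sphere_neq0 y0; rewrite rho_radial ?rho_neq0// rhoD.
- move=> g y /sphere_neq0 y0; pose k := euclidean_norm (rho g y).
  have k0 : 0 < k by exact/euclidean_norm_gt0/rho_neq0.
  move=> /(congr1 (fun z => k *: z));
    rewrite /radial scalerA divff ?gt_eqF// scale1r.
  move=> gy; apply: (rho_free g y y0); rewrite gy.
  have gyX m : rho (g *+ m) y = k ^+ m *: y.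
    elim: m => [|m IH]; first by rewrite mulr0n rho0 expr0 scale1r.
    by rewrite mulrS rhoD IH rhoZ gy scalerA exprSr.
  have /eqP : k ^+ p.+2 *: y = 1 *: y by rewrite -gyX Zp_mulrn_order rho0
    scale1r.
  rewrite -subr_eq0 -scalerBl scaler_eq0 (negPf y0) orbF subr_eq0.
  by rewrite pexpr_eq1// ?(ltW k0)// => /eqP ->; rewrite scale1r.
- exists (fun x => radial (phi x)); split.
  + by move=> x Xx; exact/sphere_radial/phi0.
  + apply: continuous_in_subspaceT => x; rewrite inE => Xx.
    by apply: continuous_comp; [exact: cphi | exact/continuous_radial/phi0].
  + by move=> g x Xx; rewrite phiE// rho_radial// phi0.
Qed.

(** The action laws are given at unit vectors only; every nonzero vector is a multiple of one, so
    linearity carries the laws to the whole space. *)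
Lemma linear_action_extend (R : realType) r N
    (a : 'Z_r -> 'rV[R]_N.+1 -> 'rV[R]_N.+1) :
  Zr_action (@sphere R N) a -> (forall g, linear (a g)) ->
  (forall y, a 0 y = y) /\ (forall g h y, a (g + h) y = a g (a h y)).
Proof.
move=> aS lin_a; have aZ g k y := scalable_linear (lin_a g) k y.
have a00 g : a g 0 = 0 by have := aZ g 0 0; rewrite /= !scale0r.
have yE (y : 'rV[R]_N.+1) : y != 0 ->
    exists2 u, @sphere R N u & exists k, y = k *: u.
  move=> y0; exists (radial y); first exact: sphere_radial.
  exists (euclidean_norm y).
  by rewrite scalerA divff ?scale1r// gt_eqF// euclidean_norm_gt0.
split=> [y|g h y]; have [->|/yE[u Su [k ->]]] := eqVneq y 0.
- exact: a00.
- by rewrite aZ (act0 aS).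
- by rewrite !a00.
- by rewrite !aZ (actD aS).
Qed.

(** A Tietze extension [h] of [f] need not be equivariant, but its average over the group is. On [A]
    the average still equals [f], since there every summand does. Outside [A] the values may leave
    the sphere, and may be zero. *)
Lemma equivariant_extension (R : realType) (p N : nat)
    (a : 'Z_p.+2 -> 'rV[R]_N.+1 -> 'rV[R]_N.+1)
    (T : topologicalType) (A : set T) (s : 'Z_p.+2 -> T -> T) f :
  normal_space T -> closed A ->
  (forall g, continuous (s g)) -> (forall g h x, s (g + h) x = s g (s h x)) ->
  (forall g x, A x -> A (s g x)) ->
  Zr_action (@sphere R N) a -> (forall g, linear (a g)) ->
  equivariant_map A (@sphere R N) s a f ->
  exists F : T -> 'rV[R]_N.+1,
    [/\ continuous F, forall g x, F (s g x) = a g (F x) & {in A, f =1 F}].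
Proof.
move=> nT cA cs sD sA aS lin_a [fS cf fE].
have [a0 aD] := linear_action_extend aS lin_a.
have f1 x i : A x -> `|f x 0 i| <= 1.
  move=> /fS; rewrite /sphere /= => f1;
    rewrite -(@expr_le1 _ 2)// real_normK ?num_real// -f1.
  by rewrite (bigD1 i)//= lerDl sumr_ge0// => j _; exact: sqr_ge0.
have [h ch fh] := tietze_rV nT cA cf ltr01 f1.
pose la g : {linear _ -> _} :=
  HB.pack (a g) (GRing.isLinear.Build _ _ _ _ (a g) (lin_a g)).
have a_sum g (F : 'Z_p.+2 -> 'rV[R]_N.+1) : a g (\sum_i F i) = \sum_i a g (F i).
  exact: (linear_sum (la g)).
have aZ g k y := scalable_linear (lin_a g) k y.
exists (fun x => p.+2%:R^-1 *: \sum_(g : 'Z_p.+2) a (- g) (h (s g x))); split.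
- apply: continuous_rV => i; rewrite (_ : (fun _ => _) =
    fun x => p.+2%:R^-1 * \sum_(g : 'Z_p.+2) a (- g) (h (s g x)) 0 i).
    move=> x; apply: (@continuousM _ _ (fun=> p.+2%:R^-1));
      first exact: cst_continuous.
    apply: continuous_sum => g _ {}x.
    apply: (@continuous_comp _ _ _ (s g) (fun x => a (- g) (h x) 0 i));
      first exact: cs.
    apply: (@continuous_comp _ _ _ h (fun y => a (- g) y 0 i)); first exact: ch.
    apply: (@continuous_comp _ _ _ (a (- g)) (fun y : 'rV[R]_N.+1 => y 0 i)).
      exact: linear_rV_continuous.
    exact: coord_continuous.
  by apply: funext => x; rewrite mxE summxE.
(* Substituting [g + k] for [g] on the right turns [a k] after [a (- (g + k))] into [a (- g)]. *)
- move=> k x; rewrite aZ a_sum [in RHS](reindex_inj (addIr k)) /=.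
  congr (_ *: _); apply: eq_bigr => g _.
  by rewrite -aD sD opprD addrCA subrr addr0.
- move=> x; rewrite inE => Ax.
  under eq_bigr => g _.
    rewrite -fh ?inE; last exact: sA.
    rewrite fE// -aD addNr a0; over.
  by rewrite sumr_const card_ord -[f x *+ _]scaler_nat scalerA mulVf
    ?pnatr_eq0// scale1r//.
Qed.

(** * Faces of the deleted join and closedness of realizations *)

Section DeletedJoin.
Variables (V : finType) (p : nat).
Implicit Types (M : {set {set V}}) (F : {set V * 'Z_p.+2}).

Definition join_slice F (i : 'Z_p.+2) : {set V} := [set v | (v, i) \in F].

Lemma in_join_face (sigma : {ffun 'Z_p.+2 -> {set V}}) v i :
  ((v, i) \in join_face sigma) = (v \in sigma i).
Proof.
apply/bigcupP/idP => [[j _]|vi]; first by rewrite !inE /= => /andP[vj /eqP ->].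
by exists i => //; rewrite !inE /= vi eqxx.
Qed.

(** The family [sigma] behind a face can only be its family of slices, so the existential over
    [sigma] disappears. *)
Lemma deleted_joinP M F :
  reflect ((forall i, join_slice F i \in M) /\
           (forall i j, i != j -> [disjoint join_slice F i & join_slice F j]))
          (F \in deleted_join p.+2 M).
Proof.
apply: (iffP imsetP) => [[sigma]|[FM Fd]].
  rewrite inE => /andP[/forallP sM /forallP sd] ->.
  have sE i : join_slice (join_face sigma) i = sigma i.
    by apply/setP => v; rewrite inE in_join_face.
  split=> [i|i j ij]; rewrite !sE//.
  by have /forallP /(_ j) /implyP := sd i; exact.
exists [ffun i => join_slice F i].
  rewrite inE; apply/andP; split; apply/forallP => i; rewrite ffunE//.
  by apply/forallP => j; rewrite ffunE; apply/implyP; exact: Fd.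
by apply/setP => -[v i]; rewrite in_join_face ffunE inE.
Qed.

Lemma deleted_join_down M F F' :
  simplicial_complex M -> F \in deleted_join p.+2 M -> F' \subset F ->
  F' \in deleted_join p.+2 M.
Proof.
move=> [_ Mdown] /deleted_joinP[FM Fd] /fintype.subsetP F'F.
have sub i : join_slice F' i \subset join_slice F i.
  by apply/fintype.subsetP => v; rewrite !inE; exact: F'F.
apply/deleted_joinP; split=> [i|i j ij]; first exact: Mdown (FM i) (sub i).
exact: disjointW (sub i) (sub j) (Fd i j ij).
Qed.

End DeletedJoin.

(** Since [M] is closed under subsets, the support of [x] is a face exactly when, for every non-face
    [s], the product of the coordinates of [x] over [s] vanishes. This is an intersection of closed
    conditions. *)
Lemma realization_closed (R : realType) (W : finType) (M : {set {set W}}) :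
  (forall s t : {set W}, s \in M -> t \subset s -> t \in M) ->
  closed (@realization R W M).
Proof.
move=> Mdown.
have -> : @realization R W M = (
    (\bigcap_w [set x : {ptws W -> R} | 0 <= x w]) `&`
    [set x : {ptws W -> R} | \sum_w x w = 1] `&`
    (\bigcap_(s in [set s | s \notin M])
       [set x : {ptws W -> R} | \prod_(w in s) x w = 0]))%classic.
  apply/seteqP; split=> x /=.
    move=> [x0 x1 xM]; split; first by split=> // w _; exact: x0.
    move=> s /= sM; apply/eqP; rewrite prodf_seq_eq0; apply/hasP.
    have [w ws xw] : exists2 w, w \in s & x w = 0.
      apply: contrapT => nx; case/negP: sM; apply: Mdown xM _.
      apply/fintype.subsetP => w ws; rewrite inE; apply/eqP => xw0; apply: nx.
      by exists w.
    by exists w; rewrite ?mem_index_enum// ws xw eqxx.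
  move=> [[x0 x1] xM]; split=> //; first by move=> w; exact: x0.
  (* The support itself, were it a non-face, would have a nonzero product. *)
  apply: contrapT => /negP nM; have /eqP := xM _ nM.
  by rewrite prodf_seq_eq0 => /hasP[w _] /andP[]; rewrite inE => /negPf ->.
apply: closedI; [apply: closedI|].
- apply: closed_bigI => w _; apply: (@preimage_closed _ _
    (fun x : {ptws W -> R} => x w) [set y | 0 <= y]%classic) => //.
    by move=> x _; exact: continuous_ptws_eval.
- apply: (@preimage_closed _ _
    (fun x : {ptws W -> R} => \sum_w x w) [set y | y = 1]%classic) => //.
  by move=> x _; apply: continuous_sum => w _; exact: continuous_ptws_eval.
- apply: closed_bigI => s _.
  apply: (@preimage_closed _ _
    (fun x : {ptws W -> R} => \prod_(w in s) x w) [set y | y = 0]%classic) => //.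
  by move=> x _; apply: continuous_prod => w _; exact: continuous_ptws_eval.
Qed.

(** * The cyclic shift on the realization *)

Section Shift.
Variables (R : realType) (V : finType) (p : nat).
Local Notation shift := (@cyclic_shift p.+2 R V).

Lemma continuous_shift g : continuous (shift g).
Proof. by apply: continuous_ptws => w; exact: continuous_ptws_eval. Qed.

Lemma shiftD g h x : shift (g + h) x = shift g (shift h x).
Proof. by apply: funext => -[v i]; rewrite /cyclic_shift /= opprD addrA. Qed.

Lemma realization_shift (M : {set {set V}}) g x :
  realization (deleted_join p.+2 M) x ->
  realization (deleted_join p.+2 M) (shift g x).
Proof.
move=> [x0 x1 /deleted_joinP[xM xd]]; split=> [w||]; first exact: x0.
  rewrite -x1 (reindex (fun w : V * 'Z_p.+2 => (w.1, w.2 + g))) /=.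
    by apply: eq_bigr => -[v i] _; rewrite /cyclic_shift /= addrK.
  exists (fun w => (w.1, w.2 - g)) => -[v i] _ /=; first by rewrite addrK.
  by rewrite subrK.
have sE i : join_slice (finset (fun w => shift g x w != 0)) i =
    join_slice (finset (fun w => x w != 0)) (i - g).
  by apply/setP => v; rewrite !inE.
apply/deleted_joinP; split=> [i|i j ij]; rewrite !sE//.
by apply: xd; rewrite (inj_eq (addIr _)).
Qed.

End Shift.

(* Coordinates on the reduced permutation representation of Z/(p+2), taken as
   the quotient of [R^(p+2)] by the constant vectors: a class is recorded by
   its differences with the entry of index 0.  There are [c] copies of it, one
   per column. *)
Section ReducedShift.
Variables (R : realType) (p c : nat).
Implicit Types (M : 'M[R]_(p.+2, c)) (w : 'M[R]_(p.+1, c)) (g h j : 'Z_p.+2).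

Definition row_diff M : 'M[R]_(p.+1, c) :=
  \matrix_(i, k) (M (lift ord0 i) k - M ord0 k).

(** The representative of a class whose row of index 0 vanishes. *)
Definition row_ext w : 'M[R]_(p.+2, c) :=
  \matrix_(j, k) if unlift ord0 j is Some i then w i k else 0.

Definition row_shift g M : 'M[R]_(p.+2, c) :=
  \matrix_(j, k) M ((j : 'Z_p.+2) - g) k.

Definition reduced_shift g w := row_diff (row_shift g (row_ext w)).

Lemma row_diffK M j k : row_ext (row_diff M) j k = M j k - M ord0 k.
Proof. by rewrite mxE; case: unliftP => [i ->|->]; rewrite ?mxE ?subrr. Qed.

Lemma row_extK w : row_diff (row_ext w) = w.
Proof. by apply/matrixP => i k; rewrite !mxE liftK unlift_none subr0. Qed.

Lemma row_ext0 w k : row_ext w ord0 k = 0.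
Proof. by rewrite mxE unlift_none. Qed.

(** The shift does not depend on the representative: [row_ext (row_diff M)] differs from [M] by a
    matrix constant in the row index, which shifting preserves and [row_diff] kills. *)
Lemma reduced_shift_diff g M :
  reduced_shift g (row_diff M) = row_diff (row_shift g M).
Proof.
apply/matrixP => i k; rewrite /reduced_shift [LHS]mxE [RHS]mxE.
rewrite ![row_shift _ _ _ _]mxE !row_diffK opprB addrA subrK.
by [].
Qed.

Lemma reduced_shift_linear g : linear (reduced_shift g).
Proof.
move=> k u w; apply/matrixP => i j; rewrite !mxE.
case: (unlift _ _) => [?|]; case: (unlift _ _) => [?|]; rewrite ?mxE; ring.
Qed.

Lemma reduced_shift0 w : reduced_shift 0 w = w.
Proof.
rewrite /reduced_shift -[RHS]row_extK; congr row_diff.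
by apply/matrixP => j k; rewrite mxE subr0.
Qed.

Lemma reduced_shiftD g h w :
  reduced_shift (g + h) w = reduced_shift g (reduced_shift h w).
Proof.
rewrite [RHS]reduced_shift_diff; congr row_diff.
by apply/matrixP => j k; rewrite !mxE opprD addrA.
Qed.

(** A representative [M] of a fixed class changes by a constant under the shift by [g]. That
    constant is zero, so [M] is constant along the multiples of [g], which are all of [Z/r] as r is
    prime. *)
Lemma reduced_shift_free g w : prime p.+2 ->
  g != 0 -> reduced_shift g w = w -> w = 0.
Proof.
move=> p_prime g0 gw; pose M := row_ext w.
have ME j k : M (j - g) k - M (- g) k = M j k.
  rewrite /M -[in RHS]gw row_diffK !mxE.
  by rewrite (_ : (ord0 : 'Z_p.+2) - g = - g) // sub0r.
(* Summing [ME] over all [j], both sums of entries of [M] agree, which leaves [p.+2] times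
   [M (- g) k] equal to 0. *)
have Mg k : M (- g) k = 0.
  have : \sum_j M j k = \sum_(j : 'Z_p.+2) (M (j - g) k - M (- g) k).
    by apply: eq_bigr => j _; rewrite ME.
  rewrite sumrB [X in X = _](reindex_inj (addIr (- g))) /=.
  move=> /esym/eqP; rewrite subr_eq addrC -subr_eq subrr eq_sym.
  by rewrite sumr_const card_ord mulrn_eq0 => /eqP.
have Mmul n k : M (g *+ n) k = 0.
  elim: n => [|n IH]; first by rewrite mulr0n row_ext0.
  by rewrite -ME Mg subr0 mulrS addrAC subrr add0r.
have gu : g \is a GRing.unit.
  rewrite -[g]natr_Zp unitZpE// prime_coprime// gtnNdvd//.
  by rewrite lt0n; apply: contra g0 => /eqP g0; apply/eqP/val_inj.
have M0 j k : M j k = 0.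
  rewrite -(Mmul (val (g^-1 * j)) k); congr (M _ k).
  by rewrite -mulr_natr natr_Zp mulrA divrr// mul1r.
by apply/matrixP => i k; rewrite -(row_extK w) mxE -/M !M0 subrr mxE.
Qed.

End ReducedShift.

(** * Weights of the colour classes *)

Section Weight.
Variables (R : realType) (V : finType) (K L : {set {set V}}) (p c : nat).
Variable col : {ffun missing_face_in K L -> 'I_c}.
Hypothesis K_complex : simplicial_complex K.
Hypothesis L_complex : simplicial_complex L.
Hypothesis col_proper :
  [forall e in KG p.+2 K L, ~~ [forall s in e, forall t in e, col s == col t]].
Implicit Type x : {ptws V * 'Z_p.+2 -> R}.

Definition weight x : 'M[R]_(p.+2, c) :=
  \matrix_(j, k) \sum_(t | col t == k) \prod_(v in val t) x (v, j : 'Z_p.+2).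

Lemma continuous_weight j k : continuous (fun x => weight x j k).
Proof.
rewrite (_ : (fun _ => _) = fun x : {ptws V * 'Z_p.+2 -> R} =>
    \sum_(t | col t == k) \prod_(v in val t) x (v, j : 'Z_p.+2)).
  apply: continuous_sum => t _; apply: continuous_prod => v _.
  exact: continuous_ptws_eval.
by apply: funext => x; rewrite mxE.
Qed.

Lemma weight_shift g x : weight (cyclic_shift g x) = row_shift g (weight x).
Proof. by apply/matrixP => j k; rewrite !mxE. Qed.

(** As the empty set lies in [K], missing faces are nonempty, so pairwise disjoint ones are
    distinct. The image of [tau] therefore has exactly r elements and is a hyperedge. *)
Lemma disjoint_missing_faces_not_monochromatic k
    (tau : 'Z_p.+2 -> missing_face_in K L) :
  (forall i j, i != j -> [disjoint val (tau i) & val (tau j)]) ->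
  ~ (forall i, col (tau i) = k).
Proof.
move=> tau_disj tau_col.
have tau_inj : injective tau.
  move=> i j tauij; apply/eqP; apply: contraT => /tau_disj.
  rewrite tauij -setI_eq0 finset.setIid => /eqP tau0.
  have /andP[/andP[]] := valP (tau j).
  by rewrite /missing_face tau0 K_complex.1.
have /forall_inP/(_ (tau @: [set: 'Z_p.+2])%SET) := col_proper.
rewrite inE card_imset// cardsT card_ord eqxx /=.
have -> : [forall s in tau @: [set: 'Z_p.+2], forall t in tau @: [set: 'Z_p.+2],
    (s != t) ==> [disjoint val s & val t]].
  apply/forall_inP => _ /imsetP[i _ ->]; apply/forall_inP => _ /imsetP[j _ ->].
  by apply/implyP => ij; apply: tau_disj; apply: contra_neq ij => ->.
move=> /(_ isT)/negP; apply.
apply/forall_inP => _ /imsetP[i _ ->]; apply/forall_inP => _ /imsetP[j _ ->].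
by rewrite !tau_col.
Qed.

Lemma row_diff_weight_eq0 x : realization (deleted_join p.+2 L) x ->
  row_diff (weight x) = 0 -> realization (deleted_join p.+2 K) x.
Proof.
move=> [x0 x1 /deleted_joinP[xL xd]] dx0.
pose supp j := join_slice (finset (fun w => x w != 0)) j.
have wE j k : weight x j k = weight x ord0 k.
  by apply/eqP; rewrite -subr_eq0 -row_diffK dx0 mxE; case: unlift => *;
    rewrite ?mxE.
have face_supp (t : missing_face_in K L) (j : 'Z_p.+2) :
    \prod_(v in val t) x (v, j) != 0 -> val t \subset supp j.
  move=> /prodf_neq0 tj; apply/fintype.subsetP => v vt.
  by rewrite !inE; exact: tj.
(* By [wE] a weight that is nonzero in one factor is nonzero in all, so each slice of the support
   contains a missing face of colour [k]; the slices are pairwise disjoint. *)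
have w0 j k : weight x j k = 0.
  apply: contrapT => /eqP wjk.
  have /choice[tau tauP] i : exists t, col t = k /\ val t \subset supp i.
    have : weight x i k != 0 by rewrite wE -(wE j).
    rewrite mxE => wik; apply: contrapT => nt; case/negP: wik; apply/eqP.
    apply: big1 => t /eqP tk; apply/eqP; apply: contraT => /face_supp ti.
    by case: nt; exists t.
  apply: (@disjoint_missing_faces_not_monochromatic k tau) => i;
    last by case: (tauP i).
  move=> l il; have [_ ti] := tauP i; have [_ tl] := tauP l.
  exact: disjointW ti tl (xd i l il).
split=> //; apply/deleted_joinP; split=> // j.
apply: contraT => njK.
(* A minimal non-face [t] of [K] inside the slice is a missing face, and lies in [L] because the
   slice does. Its monomial is a term of a zero sum of nonnegative terms, yet all its factors are
   nonzero. *)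
have [t /minsetP[tK tmin] tj] := @minset_exists _ (fun s => s \notin K) _ njK.
have tP : missing_face K t && (t \in L).
  rewrite /missing_face tK (L_complex.2 _ _ (xL j) tj) andbT /=.
  apply/forallP => s; apply/implyP => /properP[st [v vt vs]].
  apply: contraT => sK; move: vs; rewrite (tmin s sK st) vt //.
have := w0 j (col (Sub t tP)); rewrite mxE => /psumr_eq0P.
have xp (s : missing_face_in K L) : 0 <= \prod_(v in val s) x (v, j).
  by apply: prodr_ge0 => v _; exact: x0.
move=> /(_ (fun s _ => xp s) _ (eqxx _))/eqP; rewrite prodf_seq_eq0.
move=> /hasP[v _ /andP[vt]]; apply/contraLR => _.
by have /fintype.subsetP/(_ v vt) := tj; rewrite !inE.
Qed.

End Weight.

(** * Colourings with [c] colours and the construction of [F] *)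

Lemma colorable_leq (T : finType) (E : {set {set T}}) (k l : nat) :
  (k <= l)%N -> colorable E k -> colorable E l.
Proof.
move=> kl /existsP[f /forall_inP fE]; apply/existsP.
exists [ffun t => widen_ord kl (f t)]; apply/forall_inP => e /fE.
apply: contra => /forall_inP fe; apply/forall_inP => s se.
apply/forall_inP => t te.
have /forall_inP /(_ t te) := fe s se; rewrite !ffunE => /eqP[fst].
by apply/eqP/val_inj.
Qed.

(** For [r > 1] every hyperedge has two vertices, so the chromatic number is attained; the palette
    is then enlarged to [c] colours, matching the dimension of the target sphere. *)
Lemma KG_colorable (V : finType) (K L : {set {set V}}) (r c : nat) :
  (1 < r)%N -> (chromatic_number (KG r K L) <= c)%N -> colorable (KG r K L) c.
Proof.
move=> r1 /colorable_leq; apply; apply: (chromatic_numberP _).1 => e.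
by rewrite inE => /andP[/eqP ->].
Qed.

Theorem theorem5p4 (R : realType) (V : finType) (K L : {set {set V}})
    (r N c : nat) (a : 'Z_r -> 'rV[R]_N.+1 -> 'rV[R]_N.+1) :
  simplicial_complex K -> simplicial_complex L -> K \subset L ->
  prime r ->
  Zr_action (@sphere R N) a -> (forall g, linear (a g)) ->
  free_action (@sphere R N) a ->
  (exists f : {ptws V * 'Z_r -> R} -> 'rV[R]_N.+1,
     equivariant_map (@realization R _ (deleted_join r K)) (@sphere R N)
       (@cyclic_shift r R V) a f) ->
  (chromatic_number (KG r K L) <= c)%N ->
  exists b : 'Z_r -> 'rV[R]_(N + (r - 1) * c).+1 ->
             'rV[R]_(N + (r - 1) * c).+1,
    [/\ Zr_action (@sphere R (N + (r - 1) * c)) b,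
        free_action (@sphere R (N + (r - 1) * c)) b &
        exists F : {ptws V * 'Z_r -> R} -> 'rV[R]_(N + (r - 1) * c).+1,
          equivariant_map (@realization R _ (deleted_join r L))
            (@sphere R (N + (r - 1) * c)) (@cyclic_shift r R V) b F].
Proof.
case: r a => [|[|p]] // a K_cplx L_cplx _ p_prime aS lin_a a_free [f fP].
move=> /(KG_colorable (prime_gt1 p_prime))/existsP[col col_proper].
have [a0 aD] := linear_action_extend aS lin_a.
have [h [ch hE fh]] := equivariant_extension (@ptws_normal R _)
  (realization_closed (fun s t => @deleted_join_down V p K s t K_cplx))
  (@continuous_shift R V p) (@shiftD R V p) (@realization_shift R V p K) aS
    lin_a fP.
pose phi x : 'rV[R]_(N.+1 + p.+1 * c) :=
  row_mx (h x) (mxvec (row_diff (weight col x))).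
pose rho g (y : 'rV[R]_(N.+1 + p.+1 * c)) : 'rV[R]_(N.+1 + p.+1 * c) :=
  row_mx (a g (lsubmx y)) (mxvec (reduced_shift g (vec_mx (rsubmx y)))).
have rho_linear g : linear (rho g).
  move=> k u v; rewrite /rho scale_row_mx add_row_mx; congr row_mx.
    by rewrite linearP /= lin_a.
  by rewrite !linearP /= reduced_shift_linear linearP.
have rho0 y : rho 0 y = y.
  by rewrite /rho a0 reduced_shift0 vec_mxK hsubmxK.
have rhoD g g' y : rho (g + g') y = rho g (rho g' y).
  by rewrite /rho row_mxKl row_mxKr mxvecK aD reduced_shiftD.
(* For [g] nonzero the reduced part of a fixed [y] vanishes; a nonzero remaining part would project
   to a fixed point of [a g] on the sphere. *)
have rho_free g (y : 'rV[R]_(N.+1 + p.+1 * c)) : y != 0 -> rho g y = y -> g = 0.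
  move=> y0 gy; apply: contrapT => /eqP g0; case/negP: y0; apply/eqP.
  rewrite -(hsubmxK y) -[rsubmx y]vec_mxK.
  rewrite (reduced_shift_free p_prime g0 (w := vec_mx (rsubmx y))); last first.
    by rewrite -[in RHS]gy row_mxKr mxvecK.
  suff -> : lsubmx y = 0 by rewrite linear0 row_mx0.
  apply: contrapT => /eqP y0; case/eqP: g0.
  apply: (a_free g (radial (lsubmx y))); first exact: sphere_radial.
  have gl : a g (lsubmx y) = lsubmx y by rewrite -[in RHS]gy row_mxKl.
  by rewrite /radial (scalable_linear (lin_a g)) gl.
have cphi : continuous phi.
  apply: continuous_rV => i; case: (split_ordP i) => j ->.
    rewrite (_ : (fun _ => _) = (fun x => h x 0 j)).
      move=> x; apply: (@continuous_comp _ _ _ h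
        (fun y : 'rV[R]_N.+1 => y 0 j)); first exact: ch.
      exact: coord_continuous.
    by apply: funext => x; rewrite row_mxEl.
  case/mxvec_indexP: j => i' k.
  rewrite (_ : (fun _ => _) =
    fun x => weight col x (lift ord0 i') k - weight col x ord0 k).
    by move=> x; apply: continuousB; exact: continuous_weight.
  by apply: funext => x; rewrite row_mxEr mxvecE mxE.
(* At a zero of [phi] the weights do not depend on the factor, so [x] lies over [K], where [h]
   agrees with [f] and has unit length. *)
have phi_neq0 x : realization (deleted_join p.+2 L) x -> phi x != 0.
  move=> xL; apply/eqP => phi0.
  have hx0 : h x = 0.
    by rewrite -[LHS](row_mxKl _ (mxvec (row_diff (weight col x)))) -/(phi x)
      phi0 linear0.
  have dx0 : row_diff (weight col x) = 0.
    by rewrite -[LHS]mxvecK -[mxvec _](row_mxKr (h x)) -/(phi x) phi0 !linear0.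
  have xK := row_diff_weight_eq0 K_cplx L_cplx col_proper xL dx0.
  have /sphere_neq0 := eqv_maps fP xK.
  by rewrite fh ?inE// hx0 eqxx.
have phiE g x : phi (cyclic_shift g x) = rho g (phi x).
  by rewrite /phi /rho row_mxKl row_mxKr mxvecK hE weight_shift
     reduced_shift_diff.
(* The dimensions [N.+1 + p.+1 * c] and [(N + (p.+2 - 1) * c).+1] agree by computation. *)
exact: (@radial_equivariant_map R p (N + p.+1 * c) rho _ _ _ phi rho_linear rho0
  rhoD rho_free cphi phi_neq0 (fun g x _ => phiE g x)).
Qed.
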